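(* Let $(M,g)$ be a Riemannian manifold of dimension $n$ ($n\ge 2$), $(B,g_B)$ a Riemannian vector bundle of dimension (rank) $n+s$ over $M$, and $\zeta$ a $B$-valued symmetric $(1,2)$-tensor field on $M$. Suppose that for any orthonormal basis $\{e_1,\ldots,e_n\}$ of a tangent space $T_pM$ there is an orthonormal basis $\{e_{n+1},\ldots,e_{2n+s}\}$ of the fibre of $(B,g_B)$ at $p$ such that $$\zeta_{jk}^{n+i}=\zeta_{ki}^{n+j}=\zeta_{ij}^{n+k},\qquad i,j,k\in\{1,\ldots,n\},$$ $$\zeta_{ij}^{r}=0,\qquad i,j\in\{1,\ldots,n\},\ r\in\{2n+1,\ldots,2n+s\}.$$ Let $T$ be a curvature-like tensor field on $M$ satisfying the algebraic Gauss equation $$T(X,Y,Z,W)=g_B(\zeta(X,W),\zeta(Y,Z))-g_B(\zeta(X,Z),\zeta(Y,W))$$ for all vector fields $X,Y,Z,W$ on $M$. Then for any unit vector $X\in T_p^1M$, $$\mathrm{Ric}_T(X)\le\frac{n-1}{4n}\,\|\mathrm{trace}\,\zeta\|^2 .$$ The equality sign holds for every unit tangent vector at $p$ if and only if either $\zeta=0$ at $p$, or $n=2$ and, at $p$, $$\zeta(e_1,e_1)=3\mu e_{n+1},\qquad \zeta(e_2,e_2)=\mu e_{n+1},\qquad \zeta(e_1,e_2)=\mu e_{n+2}$$ for some suitable function $\mu$ with respect to some suitable orthonormal local frame field (here $e_1,e_2$ are orthonormal tangent to $M$ and $e_{n+1},e_{n+2}$ are orthonormal in $B$).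
   Context: A $(0,4)$-tensor field $T$ on $(M,g)$ is curvature-like if $T(X,Y,Z,W)=-T(Y,X,Z,W)$, $T(X,Y,Z,W)=-T(X,Y,W,Z)$ and $T(X,Y,Z,W)+T(X,Z,W,Y)+T(X,W,Y,Z)=0$ for all vector fields $X,Y,Z,W$. (A $(0,4)$-tensor field satisfying the algebraic Gauss equation is automatically curvature-like.) The $T$-Ricci tensor is $S_T(X,Y)=\sum_{j=1}^n T(e_j,X,Y,e_j)$ for $X,Y\in T_pM$, where $\{e_1,\ldots,e_n\}$ is any orthonormal basis of $T_pM$; the $T$-Ricci curvature is $\mathrm{Ric}_T(X)=S_T(X,X)$. The set of unit vectors in $T_pM$ is denoted $T_p^1M$. A $B$-valued symmetric $(1,2)$-tensor field $\zeta$ assigns to each $p\in M$ a symmetric bilinear map $\zeta:T_pM\times T_pM\to B_p$ (smoothly in $p$). For an orthonormal basis $\{e_1,\ldots,e_n\}$ of $T_pM$ and an orthonormal basis $\{e_{n+1},\ldots,e_{2n+s}\}$ of the fibre $B_p$, put $\zeta_{ij}^r=g_B(\zeta(e_i,e_j),e_r)$. Also $\mathrm{trace}\,\zeta=\sum_{i=1}^n\zeta(e_i,e_i)$ and $\|\mathrm{trace}\,\zeta\|^2=g_B(\mathrm{trace}\,\zeta,\mathrm{trace}\,\zeta)$, evaluated at $p$. Here $s\ge 0$ is an integer; if $s=0$ the second condition on $\zeta$ is vacuous. *)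

(* Defs.v *)
From HB Require Import structures.
From mathcomp Require Import all_boot all_order all_algebra.
From mathcomp Require Import all_classical all_reals topology normedtype landau.
From mathcomp Require Import derive.

Set Implicit Arguments.
Unset Strict Implicit.
Unset Printing Implicit Defensive.

Import Order.TTheory GRing.Theory Num.Theory numFieldNormedType.Exports.
Local Open Scope classical_set_scope.
Local Open Scope ring_scope.

(* On an open set [U] this is the class C^k: all iterated directional
   derivatives up to order [k] exist and are continuous. *)
Fixpoint Ck (k : nat) (R : realType) (m : nat) (W : normedModType R)
    (U : set 'rV[R]_m) (f : 'rV[R]_m -> W) : Prop :=
  match k with
  | 0%N => forall x, U x -> {for x, continuous f}
  | k'.+1 => (forall x, U x -> differentiable f x) /\
             (forall v, Ck k' U ('D_v f))
  end.

Definition smooth_on (R : realType) (m : nat) (W : normedModType R)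
    (U : set 'rV[R]_m) (f : 'rV[R]_m -> W) : Prop :=
  forall k, Ck k U f.

Lemma near_eq_differentiable (R : realType) (V W : normedModType R)
    (f g : V -> W) (x : V) :
  (\near x, f x = g x) -> differentiable f x ->
  differentiable g x /\ 'd g x = 'd f x :> (V -> W).
Proof.
move=> fg df.
have fgx : f x = g x by exact: nbhs_singleton fg.
have cf : continuous ('d f x) by exact: diff_continuous.
have E : g \o shift x = cst (g x) + 'd f x +o_ (0 : V) id.
  apply/eqaddoP => e e0.
  have /eqaddoP/(_ _ e0) H := diff_locally df.
  have H1 : \forall h \near (0 : V), f (h + x) = g (h + x).
    by move: fg; rewrite [X in X -> _](near_shift 0)/= subr0.
  near=> h.
  have Eh : f (h + x) = g (h + x) by near: h.
  rewrite /= -fgx !fctE /= -Eh.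
  by near: h; exact: H.
have D : 'd g x = 'd f x :> (V -> W) by apply: diff_unique.
split=> //; apply/diff_locallyP; rewrite D; split => //.
Unshelve. all: by end_near. Qed.

Section CkTheory.
Variables (R : realType) (m : nat).
Implicit Types (U : set 'rV[R]_m).

Lemma Ck_near (W : normedModType R) k U (f g : 'rV[R]_m -> W) : open U ->
  (forall x, U x -> f x = g x) -> Ck k U f -> Ck k U g.
Proof.
move=> oU; elim: k f g => [|k IH] f g fg /=; have nfg x : U x -> \near x, f x = g x.
- move=> Ux; apply: (@filterS _ (nbhs x) _ U) => //.
  exact: open_nbhs_nbhs.
- move=> cf x Ux.
  have H : g @ x --> f x.
    exact: cvg_trans (near_eq_cvg (nfg x Ux)) (cf x Ux).
  by rewrite (fg _ Ux) in H.
- move=> Ux; apply: (@filterS _ (nbhs x) _ U) => //.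
  exact: open_nbhs_nbhs.
move=> [df Df]; split=> [x Ux|v].
  by have [] := near_eq_differentiable (nfg x Ux) (df x Ux).
apply: IH (Df v) => x Ux; exact/near_eq_derive/nfg.
Qed.

Lemma Ck_sub (W : normedModType R) k U U' (f : 'rV[R]_m -> W) :
  U' `<=` U -> Ck k U f -> Ck k U' f.
Proof.
move=> s; elim: k f => [|k IH] f /=; first by move=> h x /s/h.
by move=> [h1 h2]; split=> [x /s/h1//|v]; apply: IH.
Qed.

Lemma CkW (W : normedModType R) k U (f : 'rV[R]_m -> W) :
  Ck k.+1 U f -> Ck k U f.
Proof.
elim: k f => [|k IH] f [h1 h2] /=.
  by move=> x Ux; apply: differentiable_continuous; exact: h1.
by split=> // v; exact: IH.
Qed.

Lemma Ck_cst (W : normedModType R) k U (a : W) : Ck k U (fun _ : 'rV[R]_m => a).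
Proof.
elim: k a => [|k IH] a /=; first by move=> x _; exact: cst_continuous.
split=> [x _|v]; first exact: differentiable_cst.
suff -> : 'D_v (fun=> a) = (fun=> 0 : W) by [].
by apply/funext => x; rewrite derive_cst.
Qed.

Lemma CkD k U (f g : 'rV[R]_m -> R) : open U ->
  Ck k U f -> Ck k U g -> Ck k U (fun x => f x + g x).
Proof.
move=> oU; elim: k f g => [|k IH] f g /=.
  by move=> cf cg x Ux; exact: (cvgD (cf x Ux) (cg x Ux)).
move=> [df Df] [dg Dg]; split=> [x Ux|v].
  by apply: differentiableD; [exact: df|exact: dg].
apply: (@Ck_near _ _ _ (fun x => 'D_v f x + 'D_v g x)) => //; last exact: IH.
by move=> x Ux; rewrite -deriveD //; apply: diff_derivable; auto.
Qed.

Lemma CkM k U (f g : 'rV[R]_m -> R) : open U ->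
  Ck k U f -> Ck k U g -> Ck k U (fun x => f x * g x).
Proof.
move=> oU; elim: k f g => [|k IH] f g.
  by move=> cf cg x Ux; exact: (cvgM (cf x Ux) (cg x Ux)).
move=> Cf Cg; have [cf cg] := (CkW Cf, CkW Cg).
move: Cf Cg => [df Df] [dg Dg]; split=> [x Ux|v].
  by apply: differentiableM; [exact: df|exact: dg].
apply: (@Ck_near _ _ _ (fun x => f x * 'D_v g x + g x * 'D_v f x)) => //.
  move=> x Ux; rewrite -[_ * _ + _]/(f x *: 'D_v g x + g x *: 'D_v f x).
  by rewrite -deriveM //; apply: diff_derivable; auto.
exact: (CkD oU (IH _ _ cf (Dg v)) (IH _ _ cg (Df v))).
Qed.

Lemma Ck_sum k U p (F : 'I_p -> 'rV[R]_m -> R) : open U ->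
  (forall i, Ck k U (F i)) -> Ck k U (fun x => \sum_i F i x).
Proof.
move=> oU; elim: p F => [|p IH] F h.
  have -> : (fun x => \sum_i F i x) = fun=> 0.
    by apply/funext => x; rewrite big_ord0.
  exact: Ck_cst.
have -> : (fun x => \sum_i F i x) = fun x => F ord0 x + \sum_i F (lift ord0 i) x.
  by apply/funext => x; rewrite big_ord_recl.
by apply: CkD => //; apply: IH.
Qed.

Lemma Ck_coord p k U (f : 'rV[R]_m -> 'rV[R]_p) j : open U ->
  Ck k U f -> Ck k U (fun x => f x 0 j).
Proof.
move=> oU; elim: k f => [|k IH] f /=.
  move=> cf x Ux.
  apply: (@continuous_comp _ _ _ f (fun M : 'rV[R]_p => M 0 j)); first exact: cf.
  exact: coord_continuous.
move=> [df Df]; split=> [x Ux|v].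
  apply: (@differentiable_comp _ _ _ _ f (fun M : 'rV[R]_p => M 0 j)).
    exact: df.
  exact: differentiable_coord.
apply: (@Ck_near _ _ _ (fun x => 'D_v f x 0 j)) => //; last exact: IH.
move=> x Ux; rewrite derive_mx ?mxE//.
by apply: diff_derivable; exact: df.
Qed.

End CkTheory.

Lemma Ck_comp (R : realType) (l m k : nat) (U : set 'rV[R]_l)
    (V : set 'rV[R]_m) (p : 'rV[R]_l -> 'rV[R]_m) (g : 'rV[R]_m -> R) :
  open U -> open V -> (forall x, U x -> V (p x)) ->
  Ck k U p -> Ck k V g -> Ck k U (g \o p).
Proof.
move=> oU oV pUV; elim: k g => [|k IH] g.
  move=> cp cg x Ux; apply: continuous_comp; first exact: cp.
  exact/cg/pUV.
move=> Cp; have cp := CkW Cp; move: Cp => [dp Dp] [dg Dg].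
split=> [x Ux|v].
  by apply: differentiable_comp; [exact: dp|exact/dg/pUV].
apply: (@Ck_near _ _ _ _ _
  (fun x => \sum_j 'D_v p x 0 j * ('D_('e_j) g \o p) x)) => //; last first.
  apply: Ck_sum => // j; exact: (CkM oU (Ck_coord _ oU (Dp v)) (IH _ cp (Dg _))).
move=> x Ux; have dpx := dp x Ux; have dgx := dg _ (pUV _ Ux).
rewrite [RHS]deriveE; last exact: differentiable_comp.
rewrite diff_comp //= -(deriveE _ dpx) [X in 'd g _ X]row_sum_delta linear_sum.
by apply: eq_bigr => j _; rewrite linearZ /= -deriveE.
Qed.

(* Hausdorff, second countable, with a smooth atlas indexed by [chart], not
   required to be maximal. [chart_inv c] inverts [chart_map c] on
   [chart_dom c] and is unconstrained outside [chart_map c @` chart_dom c].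
   [chart_at p] is a chosen chart around [p]: it makes the charts cover and
   fixes the coordinates in which tangent vectors at [p] are written. *)
Record smooth_manifold (R : realType) (n : nat) := SmoothManifold {
  carrier :> topologicalType;
  carrier_hausdorff : hausdorff_space carrier;
  carrier_second_countable : @second_countable carrier;
  chart : Type;
  chart_dom : chart -> set carrier;
  chart_map : chart -> carrier -> 'rV[R]_n;
  chart_inv : chart -> 'rV[R]_n -> carrier;
  chart_at : carrier -> chart;
  chart_dom_at : forall p, chart_dom (chart_at p) p;
  chart_dom_open : forall c, open (chart_dom c);
  chart_img_open : forall c, open (chart_map c @` chart_dom c);
  chart_mapK : forall c p, chart_dom c p -> chart_inv c (chart_map c p) = p;
  chart_map_continuous : forall c p,
    chart_dom c p -> {for p, continuous (chart_map c)};
  chart_inv_continuous : forall c p,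
    chart_dom c p -> {for chart_map c p, continuous (chart_inv c)};
  transition_smooth : forall c d,
    smooth_on (chart_map c @` (chart_dom c `&` chart_dom d))
              (chart_map d \o chart_inv c) }.

Definition smooth_fun (R : realType) (n : nat) (M : smooth_manifold R n)
    (U : set M) (f : M -> R) : Prop :=
  forall c : chart M,
    smooth_on (chart_map c @` (chart_dom c `&` U)) (f \o chart_inv c).

(* A smooth rank-[k] vector bundle, presented by local trivializations: each
   [a : triv] gives a frame of the fibres over the open set [triv_dom a], and
   the matrices relating two such frames are smooth on the overlap. These data
   determine the smooth structure of the total space. *)
Record vector_bundle (R : realType) (n : nat) (M : smooth_manifold R n)
    (k : nat) := VectorBundle {
  fiber :> M -> vectType R;
  triv : Type;
  triv_dom : triv -> set M;
  triv_frame : triv -> 'I_k -> forall p : M, fiber p;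
  triv_dom_open : forall a, open (triv_dom a);
  triv_cover : forall p, exists a, triv_dom a p;
  triv_basis : forall a p,
    triv_dom a p -> basis_of fullv [tuple triv_frame a i p | i < k];
  triv_smooth : forall a b i j,
    smooth_fun (triv_dom a `&` triv_dom b)
      (fun p => coord [tuple triv_frame b l p | l < k] j (triv_frame a i p)) }.

Section Tangent.
Variables (R : realType) (n : nat) (M : smooth_manifold R n).

(* T_pM is 'rV[R]_n, a vector being written in the coordinates of [chart_at p];
   [tangent_frame c i] is the coordinate vector field of the [i]-th coordinate
   of the chart [c]. *)
Definition tangent_frame (c : chart M) (i : 'I_n) (p : M) : 'rV[R]_n :=
  'D_('e_i) (chart_map (chart_at p) \o chart_inv c) (chart_map c p).

Lemma chart_img_openI (c : chart M) (A : set M) :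
  open A -> open (chart_map c @` (chart_dom c `&` A)).
Proof.
move=> oA; rewrite openE => _ [p [cp Ap] <-].
have H1 : nbhs (chart_map c p) (chart_map c @` chart_dom c).
  by apply: open_nbhs_nbhs; split; [exact: chart_img_open|exists p].
have H2 : nbhs (chart_map c p) (chart_inv c @^-1` A).
  apply: (chart_inv_continuous cp).
  by rewrite chart_mapK//; apply: open_nbhs_nbhs.
rewrite /interior /=; apply: filterS2 H1 H2 => x [q cq <-].
by rewrite /= chart_mapK// => Aq; exists q.
Qed.

Local Notation tr c d := (chart_map d \o chart_inv c).

Lemma transition_differentiable (c d : chart M) p :
  chart_dom c p -> chart_dom d p -> differentiable (tr c d) (chart_map c p).
Proof.
move=> cp dp; have [+ _] := @transition_smooth _ _ M c d 1%N.
by apply; exists p.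
Qed.

Lemma transition_chain (c d e : chart M) p i :
  chart_dom c p -> chart_dom d p -> chart_dom e p ->
  'D_('e_i) (tr c e) (chart_map c p) =
  \sum_l 'D_('e_i) (tr c d) (chart_map c p) 0 l *:
         'D_('e_l) (tr d e) (chart_map d p).
Proof.
move=> cp dp ep.
have E : \forall x \near chart_map c p, tr c e x =
                              (tr d e \o tr c d) x.
  have : nbhs (chart_map c p) (chart_map c @` (chart_dom c `&` chart_dom d)).
    apply: open_nbhs_nbhs; split; last by exists p.
    exact/chart_img_openI/chart_dom_open.
  apply: filterS => _ [q [cq dq] <-].
  by rewrite /= !chart_mapK.
have D1 := transition_differentiable cp dp.
have D2 := transition_differentiable dp ep.
have Ep : tr c d (chart_map c p) = chart_map d p by rewrite /= chart_mapK.
have D2' : differentiable (tr d e) (tr c d (chart_map c p)) by rewrite Ep.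
rewrite (near_eq_derive _ E) deriveE; last exact: differentiable_comp.
rewrite diff_comp //= -[X in 'd _ _ X](deriveE _ D1).
rewrite [X in 'd _ _ X]row_sum_delta linear_sum.
by apply: eq_bigr => l _; rewrite linearZ /= -deriveE ?chart_mapK// -Ep.
Qed.

Lemma transition_id (c : chart M) p (i : 'I_n) : chart_dom c p ->
  'D_('e_i) (tr c c) (chart_map c p) = 'e_i.
Proof.
move=> cp; rewrite (@near_eq_derive _ _ _ _ id); first by rewrite derive_id.
have : nbhs (chart_map c p) (chart_map c @` chart_dom c).
  by apply: open_nbhs_nbhs; split; [exact: chart_img_open|exists p].
by apply: filterS => _ [q cq <-] /=; rewrite chart_mapK.
Qed.

Lemma tangent_basis (c : chart M) p : chart_dom c p ->
  basis_of fullv [tuple tangent_frame c i p | i < n].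
Proof.
move=> cp; rewrite basisEdim size_tuple dimvf /dim /= mul1n leqnn andbT.
apply/subvP => v _; rewrite [v]row_sum_delta.
apply: memv_suml => i _; apply: memvZ.
have ap := chart_dom_at p.
rewrite -(transition_id i ap) (transition_chain i ap cp ap).
apply: memv_suml => l _; apply: memvZ; apply: memv_span.
by apply/mapP; exists l; rewrite ?mem_enum.
Qed.

Lemma tangent_coord (c d : chart M) p i l : chart_dom c p -> chart_dom d p ->
  coord [tuple tangent_frame d j p | j < n] l (tangent_frame c i p) =
  'D_('e_i) (tr c d) (chart_map c p) 0 l.
Proof.
move=> cp dp; rewrite {2}/tangent_frame.
rewrite (transition_chain i cp dp (chart_dom_at p)).
have /andP[_ fr] := tangent_basis dp.
rewrite -[RHS](coord_sum_free (fun j => 'D_('e_i) (tr c d) (chart_map c p) 0 j)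
  l fr).
congr (coord _ l _); apply: eq_bigr => j _.
by rewrite -tnth_nth tnth_mktuple.
Qed.

Lemma tangent_smooth (c d : chart M) i l :
  smooth_fun (chart_dom c `&` chart_dom d)
    (fun p => coord [tuple tangent_frame d j p | j < n] l (tangent_frame c i p)).
Proof.
move=> e k; have oI : open (chart_dom c `&` chart_dom d).
  by apply: openI; exact: chart_dom_open.
have oU := chart_img_openI (c := e) oI.
have oV : open (chart_map c @` (chart_dom c `&` chart_dom d)).
  exact/chart_img_openI/chart_dom_open.
apply: (@Ck_near _ _ _ _ _
  ((fun x => 'D_('e_i) (tr c d) x 0 l) \o tr e c)) => //.
  by move=> _ [p [ep [cp dp]] <-]; rewrite /= chart_mapK// tangent_coord.
apply: (@Ck_comp _ _ _ _ _ (chart_map c @` (chart_dom c `&` chart_dom d))) => //.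
- move=> _ [p [ep [cp dp]] <-]; exists p => //.
  by rewrite /= chart_mapK.
- apply: Ck_sub (@transition_smooth _ _ M e c k).
  by move=> _ [p [ep [cp dp]] <-]; exists p.
- apply: Ck_coord => //.
  by have [_] := @transition_smooth _ _ M c d k.+1; apply.
Qed.

Definition tangent_bundle : vector_bundle M n :=
  @VectorBundle R n M n (fun=> 'rV[R]_n) (chart M) (@chart_dom R n M)
    tangent_frame (@chart_dom_open R n M)
    (fun p => ex_intro _ (chart_at p) (chart_dom_at p))
    tangent_basis tangent_smooth.

End Tangent.

Definition smooth_section (R : realType) (n k : nat) (M : smooth_manifold R n)
    (E : vector_bundle M k) (U : set M) (x : forall p, E p) : Prop :=
  forall (a : triv E) j, smooth_fun (triv_dom a `&` U)
    (fun p => coord [tuple triv_frame a l p | l < k] j (x p)).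

Record bundle_metric (R : realType) (n k : nat) (M : smooth_manifold R n)
    (E : vector_bundle M k) := BundleMetric {
  inner :> forall p, E p -> E p -> R;
  inner_sym : forall p (u v : E p), inner u v = inner v u;
  inner_linear : forall p (v : E p), scalar (fun u => inner u v);
  inner_gt0 : forall p (u : E p), u != 0 -> 0 < inner u u;
  inner_smooth : forall (a : triv E) i j, smooth_fun (triv_dom a)
    (fun p => inner (triv_frame a i p) (triv_frame a j p)) }.

Definition orthonormal_basis (R : realType) (n k : nat)
    (M : smooth_manifold R n) (E : vector_bundle M k) (g : bundle_metric E)
    (p : M) (e : 'I_k -> E p) : Prop :=
  basis_of fullv [tuple e i | i < k] /\
  forall i j, g p (e i) (e j) = (i == j)%:R.

Definition orthonormal_frame (R : realType) (n k : nat)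
    (M : smooth_manifold R n) (E : vector_bundle M k) (g : bundle_metric E)
    (U : set M) (e : 'I_k -> forall p, E p) : Prop :=
  (forall i, smooth_section U (e i)) /\
  forall p, U p -> orthonormal_basis g (fun i => e i p).

(* A tensor field is given by its values on tangent vectors at each point; it is
   smooth when its components in the coordinate frames are. *)
Section TensorFields.
Variables (R : realType) (n k : nat) (M : smooth_manifold R n).
Variables (B : vector_bundle M k).
Local Notation TM := (tangent_bundle M).

Definition symmetric_tensor_field12
    (zeta : forall p : M, TM p -> TM p -> B p) : Prop :=
  [/\ forall p (X Y : TM p), zeta p X Y = zeta p Y X,
      forall p (Y : TM p), linear (fun X => zeta p X Y),
      forall p (X : TM p), linear (fun Y => zeta p X Y) &
      forall (c : triv TM) i j, smooth_section (triv_dom c)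
        (fun p => zeta p (triv_frame c i p) (triv_frame c j p))].

Definition tensor_field04
    (T : forall p : M, TM p -> TM p -> TM p -> TM p -> R) : Prop :=
  [/\ forall p (Y Z W : TM p), scalar (fun X => T p X Y Z W),
      forall p (X Z W : TM p), scalar (fun Y => T p X Y Z W),
      forall p (X Y W : TM p), scalar (fun Z => T p X Y Z W),
      forall p (X Y Z : TM p), scalar (fun W => T p X Y Z W) &
      forall (c : triv TM) i j l m, smooth_fun (triv_dom c)
        (fun p => T p (triv_frame c i p) (triv_frame c j p)
                      (triv_frame c l p) (triv_frame c m p))].

Definition curvature_like
    (T : forall p : M, TM p -> TM p -> TM p -> TM p -> R) : Prop :=
  forall p (X Y Z W : TM p),
    [/\ T p X Y Z W = - T p Y X Z W,
        T p X Y Z W = - T p X Y W Z &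
        T p X Y Z W + T p X Z W Y + T p X W Y Z = 0].

Definition algebraic_Gauss (gB : bundle_metric B)
    (zeta : forall p : M, TM p -> TM p -> B p)
    (T : forall p : M, TM p -> TM p -> TM p -> TM p -> R) : Prop :=
  forall p (X Y Z W : TM p),
    T p X Y Z W = gB p (zeta p X W) (zeta p Y Z) - gB p (zeta p X Z) (zeta p Y W).

(* The following traces are taken along a given basis [e] of the tangent space;
   they are used with [e] orthonormal, and then do not depend on [e]. *)
Definition ricci_tensor (T : forall p : M, TM p -> TM p -> TM p -> TM p -> R)
    (p : M) (e : 'I_n -> TM p) (X Y : TM p) : R :=
  \sum_j T p (e j) X Y (e j).

Definition ricci (T : forall p : M, TM p -> TM p -> TM p -> TM p -> R)
    (p : M) (e : 'I_n -> TM p) (X : TM p) : R :=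
  ricci_tensor T e X X.

Definition trace12 (zeta : forall p : M, TM p -> TM p -> B p)
    (p : M) (e : 'I_n -> TM p) : B p :=
  \sum_i zeta p (e i) (e i).

Definition component12 (gB : bundle_metric B)
    (zeta : forall p : M, TM p -> TM p -> B p)
    (p : M) (e : 'I_n -> TM p) (f : 'I_k -> B p) (i j : 'I_n) (r : 'I_k) : R :=
  gB p (zeta p (e i) (e j)) (f r).

End TensorFields.

(* Main.v *)
From HB Require Import structures.
Require Import Defs.
From mathcomp Require Import all_boot all_order all_algebra.
From mathcomp Require Import all_classical all_reals topology normedtype derive.
From mathcomp Require Import realfun ring lra zify.

Set Implicit Arguments.
Unset Strict Implicit.
Unset Printing Implicit Defensive.

Import Order.TTheory GRing.Theory Num.Theory numFieldNormedType.Exports.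
Local Open Scope classical_set_scope.
Local Open Scope ring_scope.

(** Everything happens in one fibre, except that the normal form in dimension
    two is asked for along smooth local frames.

    Fix a point and a pair of orthonormal bases [e], [f] for which the
    components [h i j k = <zeta(e_i, e_j), f_k>] are totally symmetric. With
    [S_k = \sum_j h j j k], the Gauss equation gives
    [Ric(e_a) = \sum_k h a a k * S_k - \sum_(j, k) (h j a k)^2] and
    [|trace zeta|^2 = \sum_k S_k^2]. Using the symmetry of [h], the difference
    of the two sides of the inequality is a sum of squares with nonnegative
    coefficients ([array_deficit], [array_deficitE]). Every unit vector is a
    member of an orthonormal basis ([orthonormal_basis_through]), and the traces
    do not depend on the basis ([trace_orthonormal]), so the inequality follows.

    Equality makes each square vanish. For [n > 2] the sum of squares contains
    [S_k^2] for [k != a] with a positive coefficient; letting [a] vary kills all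
    the [S_k] and then all of [h] ([array_deficit_eq0_gt2]). For [n = 2] that
    coefficient is zero, and equality only says that the cubic form of [h] is
    [3 * l(X) * |X|^2] for a linear form [l]. In a basis whose first vector is
    dual to [l] this is the announced normal form
    ([ricci_eq_dim2_normal_form]); conversely both sides are then [2 * mu^2]
    ([normal_form_ricci_eq]).

    Finally an orthonormal basis of one fibre extends to a smooth orthonormal
    frame: combine a local trivialization with constant coefficients and apply
    the Gram-Schmidt process, which is smooth and does not change the value at
    a point where the frame is already orthonormal
    ([orthonormal_frame_extension]). The function [mu] can be taken constant,
    since the normal form is only required at the point. *)

(** * Smooth functions and sections *)

Lemma is_derive_invsqrt (R : realType) (y : R) : 0 < y ->
  is_derive y 1 (fun t : R => (Num.sqrt t)^-1)
    (- 2^-1 * (Num.sqrt y)^-1 ^+ 3).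
Proof.
move=> y0; have s0 : Num.sqrt y != 0 by rewrite gt_eqF// sqrtr_gt0.
have dsqrt := is_derive1_sqrt y0.
have dinv : is_derive y 1 (fun t : R => (Num.sqrt t)^-1)
  (- Num.sqrt y ^- 2 *: (2 * Num.sqrt y)^-1) by exact: is_deriveV.
apply: is_derive_eq dinv _; rewrite -[_ *: _]/(_ * _).
by field; rewrite s0.
Qed.

(** The derivative of [f^(-1/2)] is [-1/2 * (f^(-1/2))^3 * f'], so one order of
    regularity of the derivative follows from the regularity one order lower
    of the function itself. *)
Lemma Ck_invsqrt (R : realType) (m k : nat) (U : set 'rV[R]_m)
    (f : 'rV[R]_m -> R) : open U -> (forall x, U x -> 0 < f x) ->
  Ck k U f -> Ck k U (fun x => (Num.sqrt (f x))^-1).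
Proof.
move=> oU f0; pose h (t : R) := (Num.sqrt t)^-1.
have dh x : U x -> differentiable h (f x).
  move=> Ux; apply/derivable1_diffP.
  by have [] := is_derive_invsqrt (f0 x Ux).
elim: k => [cf x Ux|k IH Cf].
  apply: (@continuous_comp _ _ _ f h); first exact: cf.
  exact/differentiable_continuous/dh.
have Ch := IH (CkW Cf); have [df Df] := Cf; split=> [x Ux|v].
  by apply: (@differentiable_comp _ _ _ _ f h); [exact: df|exact: dh].
apply: (@Ck_near _ _ _ _ _
  (fun x => - 2^-1 * (h (f x) * (h (f x) * h (f x))) * 'D_v f x)) => //.
  move=> x Ux; rewrite -[RHS]/('D_v (h \o f) x).
  rewrite [RHS]deriveE; last by apply: differentiable_comp; [exact: df|exact: dh].
  rewrite diff_comp; [|exact: df|exact: dh] => /=.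
  rewrite -(deriveE _ (df x Ux)) -[X in _ = 'd h _ X]mulr1.
  rewrite -[X in 'd h _ X]/('D_v f x *: (1 : R)) linearZ /=.
  rewrite -(deriveE _ (dh x Ux)) /h.
  have [_ ->] := is_derive_invsqrt (f0 x Ux).
  by rewrite -[_ *: _]/(_ * _) !exprS expr0 mulr1 mulrC.
apply: (CkM oU _ (Df v)); apply: (CkM oU (@Ck_cst _ _ _ _ _ _)).
by do 2!apply: (CkM oU Ch).
Qed.

Section SmoothFunctions.
Variables (R : realType) (n : nat) (M : smooth_manifold R n).
Implicit Types (U V : set M) (f h : M -> R).

Lemma smooth_fun_eq U f h : open U -> (forall q, U q -> f q = h q) ->
  smooth_fun U f -> smooth_fun U h.
Proof.
move=> oU fh sf c k; apply: Ck_near (sf c k); first exact: chart_img_openI.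
by move=> _ [q [cq Uq] <-]; rewrite /= chart_mapK ?fh.
Qed.

Lemma smooth_fun_sub U V f : V `<=` U -> smooth_fun U f -> smooth_fun V f.
Proof.
move=> VU sf c k; apply: Ck_sub (sf c k).
by move=> _ [q [cq Vq] <-]; exists q => //; split=> //; exact: VU.
Qed.

Lemma smooth_fun_cst U (a : R) : smooth_fun U (fun _ : M => a).
Proof. by move=> c k; exact: Ck_cst. Qed.

Lemma smooth_funD U f h : open U -> smooth_fun U f -> smooth_fun U h ->
  smooth_fun U (fun q => f q + h q).
Proof.
by move=> oU sf sh c k; apply: CkD; [exact: chart_img_openI|exact: sf|exact: sh].
Qed.

Lemma smooth_funM U f h : open U -> smooth_fun U f -> smooth_fun U h ->
  smooth_fun U (fun q => f q * h q).
Proof.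
by move=> oU sf sh c k; apply: CkM; [exact: chart_img_openI|exact: sf|exact: sh].
Qed.

Lemma smooth_fun_sum U m (F : 'I_m -> M -> R) : open U ->
  (forall i, smooth_fun U (F i)) -> smooth_fun U (fun q => \sum_i F i q).
Proof.
move=> oU sF c k.
apply: (Ck_sum (F := fun i => F i \o chart_inv c)); first exact: chart_img_openI.
by move=> i; exact: sF.
Qed.

Lemma smooth_fun_invsqrt U f : open U -> (forall q, U q -> 0 < f q) ->
  smooth_fun U f -> smooth_fun U (fun q => (Num.sqrt (f q))^-1).
Proof.
move=> oU f0 sf c k; apply: Ck_invsqrt (sf c k); first exact: chart_img_openI.
by move=> _ [q [cq Uq] <-]; rewrite /= chart_mapK//; exact: f0.
Qed.

End SmoothFunctions.

Section SmoothSections.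
Variables (R : realType) (n k : nat) (M : smooth_manifold R n).
Variables (E : vector_bundle M k).
Implicit Types (U V : set M) (x y : forall q : M, E q).

Lemma smooth_section_triv (a : triv E) i :
  smooth_section (triv_dom a) (triv_frame a i).
Proof. by move=> b j; rewrite setIC; exact: triv_smooth. Qed.

Lemma smooth_section_sub U V x : V `<=` U ->
  smooth_section U x -> smooth_section V x.
Proof.
by move=> VU sx a j; apply: smooth_fun_sub (sx a j); exact: setIS.
Qed.

Let open_trivI U (a : triv E) : open U -> open (triv_dom a `&` U).
Proof. by move=> oU; apply: openI => //; exact: triv_dom_open. Qed.

Lemma smooth_sectionD U x y : open U -> smooth_section U x ->
  smooth_section U y -> smooth_section U (fun q => x q + y q).
Proof.
move=> oU sx sy a j.
apply: smooth_fun_eq (smooth_funD (open_trivI a oU) (sx a j) (sy a j)).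
  exact: open_trivI.
by move=> q _; rewrite linearD.
Qed.

Lemma smooth_sectionZ U (f : M -> R) x : open U -> smooth_fun U f ->
  smooth_section U x -> smooth_section U (fun q => f q *: x q).
Proof.
move=> oU sf sx a j; have oaU := open_trivI a oU.
have sfa : smooth_fun (triv_dom a `&` U) f.
  by apply: smooth_fun_sub sf; exact: subIsetr.
apply: smooth_fun_eq (smooth_funM oaU sfa (sx a j)) => // q _.
by rewrite linearZ.
Qed.

Lemma smooth_section_sum U m (P : pred 'I_m) (x : 'I_m -> forall q : M, E q) :
  open U -> (forall i, P i -> smooth_section U (x i)) ->
  smooth_section U (fun q => \sum_(i | P i) x i q).
Proof.
move=> oU sx a j; have oaU := open_trivI a oU.
pose t q := [tuple triv_frame a l q | l < k].
pose F i q := if P i then coord (t q) j (x i q) else 0.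
have sF i : smooth_fun (triv_dom a `&` U) (F i).
  rewrite /F; case: (P i) (@sx i) => [sxi|_]; first exact: sxi.
  exact: smooth_fun_cst.
apply: smooth_fun_eq (smooth_fun_sum oaU sF) => // q _.
by rewrite linear_sum [RHS]big_mkcond.
Qed.

Lemma triv_frame_coord (a : triv E) q (v : E q) : triv_dom a q ->
  v = \sum_l coord [tuple triv_frame a l q | l < k] l v *: triv_frame a l q.
Proof.
move=> aq; have {1}-> := coord_basis (triv_basis aq) (memvf v).
by apply: eq_bigr => i _; rewrite -tnth_nth tnth_mktuple.
Qed.

End SmoothSections.

(** * Orthonormal bases of a fibre *)

(** Stated on functions from ordinals rather than on tuples, so that one vector
    of a family can be replaced without casting. *)
Definition lin_indep (R : realType) (V : lmodType R) k (v : 'I_k -> V) : Prop :=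
  forall c : 'I_k -> R, \sum_i c i *: v i = 0 -> forall i, c i = 0.

Lemma lin_indep_neq0 (R : realType) (V : lmodType R) k (v : 'I_k -> V) i :
  lin_indep v -> v i != 0.
Proof.
move=> fv; apply/eqP => vi0; have := fv (fun j => (j == i)%:R).
suff sum0 : \sum_j (j == i)%:R *: v j = 0.
  by move=> /(_ sum0 i)/eqP; rewrite eqxx oner_eq0.
rewrite (bigD1 i)//= vi0 scaler0 add0r big1// => j /negPf ->.
by rewrite scale0r.
Qed.

(** The update multiplies the family by an invertible matrix that differs from
    the identity in one row. The coefficients [d] of the proof are those of a
    relation between the updated vectors, rewritten in terms of the original
    ones. *)
Lemma lin_indep_update (R : realType) (V : lmodType R) k (v : 'I_k -> V) i0
    (P : pred 'I_k) (b : 'I_k -> R) (r : R) : ~~ P i0 -> r != 0 ->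
  lin_indep v ->
  lin_indep (fun i => if i == i0
    then r *: (v i0 + \sum_(j | P j) b j *: v j) else v i).
Proof.
move=> Pi0 r0 fv c; rewrite (bigD1 i0)//= eqxx => sum0.
pose d i := if i == i0 then c i0 * r
            else c i + (if P i then c i0 * r * b i else 0).
have d0 : forall i, d i = 0.
  apply: fv; rewrite -[RHS]sum0 (bigD1 i0)//= {1}/d eqxx !scalerDr !scalerA.
  rewrite -addrA.
  congr (_ + _); rewrite scaler_sumr [X in _ = X + _]big_mkcond.
  rewrite [X in _ = X + _](bigD1 i0)//= (negPf Pi0) add0r -big_split /=.
  apply: eq_bigr => i ne.
  rewrite /d (negPf ne) scalerDl addrC scalerA; congr (_ + _).
  by case: ifP; rewrite ?scale0r.
have ci0 : c i0 = 0.
  have /eqP := d0 i0; rewrite /d eqxx mulf_eq0 (negPf r0) orbF.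
  by move=> /eqP.
move=> i; have := d0 i; rewrite /d; case: eqP => [-> //|_].
by rewrite ci0 !mul0r if_same addr0.
Qed.

Section Fibre.
Variables (R : realType) (n k : nat) (M : smooth_manifold R n).
Variables (E : vector_bundle M k) (g : bundle_metric E) (p : M).
Implicit Types (u v w : E p) (e : 'I_k -> E p).

Lemma innerDl u v w : g p (u + v) w = g p u w + g p v w.
Proof. by have := inner_linear g w 1 u v; rewrite scale1r mul1r. Qed.

Lemma inner0l w : g p 0 w = 0.
Proof. by apply: (addrI (g p 0 w)); rewrite -innerDl !addr0. Qed.

Lemma innerZl a u w : g p (a *: u) w = a * g p u w.
Proof. by have := inner_linear g w a u 0; rewrite addr0 inner0l addr0. Qed.

Lemma innerDr u v w : g p w (u + v) = g p w u + g p w v.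
Proof. by rewrite !(inner_sym g w) innerDl. Qed.

Lemma innerZr a u w : g p w (a *: u) = a * g p w u.
Proof. by rewrite !(inner_sym g w) innerZl. Qed.

Lemma inner_suml I (r : seq I) (P : pred I) (F : I -> E p) w :
  g p (\sum_(i <- r | P i) F i) w = \sum_(i <- r | P i) g p (F i) w.
Proof. by elim/big_rec2 : _ => [|i y x _ <-]; rewrite ?inner0l ?innerDl. Qed.

Lemma inner_sumr I (r : seq I) (P : pred I) (F : I -> E p) w :
  g p w (\sum_(i <- r | P i) F i) = \sum_(i <- r | P i) g p w (F i).
Proof.
by rewrite inner_sym inner_suml; apply: eq_bigr => i _; rewrite inner_sym.
Qed.

Lemma lin_indep_basis e : lin_indep e -> basis_of fullv [tuple e i | i < k].
Proof.
move=> fe; have [a ap] := triv_cover E p.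
have dimE : \dim {:E p} = k := size_basis (triv_basis ap).
rewrite basisEfree subvf size_tuple dimE leqnn !andbT.
apply/freeP => c; under eq_bigr do rewrite -tnth_nth tnth_mktuple.
exact: fe.
Qed.

Lemma basis_lin_indep e : basis_of fullv [tuple e i | i < k] -> lin_indep e.
Proof.
move=> /basis_free/freeP fe c sum0; apply: fe.
by under eq_bigr do rewrite -tnth_nth tnth_mktuple.
Qed.

Lemma orthonormal_basisP e :
  (forall i j, g p (e i) (e j) = (i == j)%:R) -> orthonormal_basis g e.
Proof.
move=> oe; split=> //; apply: lin_indep_basis => c sum0 i.
have := inner0l (e i); rewrite -sum0 inner_suml (bigD1 i)//= big1 => [|j ji].
  by rewrite innerZl oe eqxx mulr1 addr0.
by rewrite innerZl oe (negPf ji) mulr0.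
Qed.

Lemma orthonormal_expansion e v : orthonormal_basis g e ->
  v = \sum_i g p v (e i) *: e i.
Proof.
move=> [be oe]; have ve := coord_basis be (memvf v).
set c := fun i => coord [tuple e i | i < k] i v.
have vc : v = \sum_i c i *: e i.
  by rewrite {1}ve; apply: eq_bigr => i _; rewrite -tnth_nth tnth_mktuple.
rewrite {1}vc; apply: eq_bigr => i _; congr (_ *: _).
rewrite vc inner_suml (bigD1 i)//= big1 => [|j ji].
  by rewrite innerZl oe eqxx mulr1 addr0.
by rewrite innerZl oe (negPf ji) mulr0.
Qed.

Lemma inner_parseval e u v : orthonormal_basis g e ->
  g p u v = \sum_i g p u (e i) * g p v (e i).
Proof.
move=> oe; rewrite {1}(orthonormal_expansion u oe) inner_suml.
by apply: eq_bigr => i _; rewrite innerZl (inner_sym g v).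
Qed.

(** The change of basis is an orthogonal matrix: expanding [e' j] in [e] and
    summing over [j] leaves [\sum_j <e_i, e'_j> <e_l, e'_j> = <e_i, e_l>], by
    the Parseval identity of [e']. *)
Lemma trace_orthonormal (W : lmodType R) (b : E p -> E p -> W) e e' :
  (forall v, linear (b^~ v)) -> (forall u, linear (b u)) ->
  orthonormal_basis g e -> orthonormal_basis g e' ->
  \sum_i b (e i) (e i) = \sum_i b (e' i) (e' i).
Proof.
move=> bl br oe oe'.
have suml (c : 'I_k -> R) v : b (\sum_i c i *: e i) v = \sum_i c i *: b (e i) v.
  pose bv := GRing.isLinear.Build _ _ _ _ _ (bl v).
  pose f : {linear E p -> W} := HB.pack (b^~ v) bv.
  rewrite -[LHS]/(f _) linear_sum; apply: eq_bigr => i _.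
  by rewrite linearZ.
have sumr (c : 'I_k -> R) u : b u (\sum_i c i *: e i) = \sum_i c i *: b u (e i).
  pose bu := GRing.isLinear.Build _ _ _ _ _ (br u).
  pose f : {linear E p -> W} := HB.pack (b u) bu.
  rewrite -[LHS]/(f _) linear_sum; apply: eq_bigr => i _.
  by rewrite linearZ.
transitivity (\sum_j \sum_i \sum_l
    (g p (e i) (e' j) * g p (e l) (e' j)) *: b (e i) (e l)); last first.
  apply: eq_bigr => j _.
  rewrite [in RHS](orthonormal_expansion (e' j) oe) suml.
  apply: eq_bigr => i _; rewrite sumr scaler_sumr; apply: eq_bigr => l _.
  by rewrite scalerA !(inner_sym g (e' j)).
rewrite exchange_big /=; apply: eq_bigr => i _; rewrite exchange_big /=.
rewrite (bigD1 i)//= [X in _ + X]big1 => [|l li];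
  rewrite -scaler_suml -(inner_parseval _ _ oe').
  by case: oe => _ ->; rewrite eqxx scale1r addr0.
by case: oe => _ ->; rewrite eq_sym (negPf li) scale0r.
Qed.

Lemma innerBl u v w : g p (u - v) w = g p u w - g p v w.
Proof. by rewrite innerDl -scaleN1r innerZl mulN1r. Qed.

Lemma innerBr u v w : g p w (u - v) = g p w u - g p w v.
Proof. by rewrite !(inner_sym g w) innerBl. Qed.

Definition hyperplane_reflection u v : E p := v - (2 * g p v u / g p u u) *: u.

Lemma inner_hyperplane_reflection u v w : u != 0 ->
  g p (hyperplane_reflection u v) (hyperplane_reflection u w) = g p v w.
Proof.
move=> u0; have uu : g p u u != 0 by rewrite gt_eqF// inner_gt0.
rewrite /hyperplane_reflection !(innerBl, innerBr, innerZl, innerZr).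
by rewrite (inner_sym g u w); field.
Qed.

Lemma hyperplane_reflection_swap u v : u != v -> g p u u = g p v v ->
  hyperplane_reflection (u - v) v = u.
Proof.
rewrite -subr_eq0 => uv0 uv.
have uvv : g p (u - v) (u - v) = - 2 * g p v (u - v).
  by rewrite !(innerBl, innerBr) uv (inner_sym g v u); ring.
have ne0 : g p v (u - v) != 0.
  move: (inner_gt0 g uv0); rewrite uvv; apply: contraTneq => ->.
  by rewrite mulr0 ltxx.
rewrite /hyperplane_reflection uvv.
rewrite (_ : _ / _ = -1); last by field; rewrite ne0.
by rewrite scaleN1r opprK addrC subrK.
Qed.

(** The reflection in the hyperplane orthogonal to [X - e i0] carries [e i0] to
    [X], so the image of [e] under it is the required basis. *)
Lemma orthonormal_basis_through e i0 X : orthonormal_basis g e ->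
  g p X X = 1 -> exists2 e', orthonormal_basis g e' & e' i0 = X.
Proof.
move=> oe X1; have [_ oee] := oe.
have [->|Xe] := eqVneq X (e i0); first by exists e.
exists (fun i => hyperplane_reflection (X - e i0) (e i)).
  apply: orthonormal_basisP => i j.
  by rewrite inner_hyperplane_reflection ?subr_eq0.
by rewrite hyperplane_reflection_swap// X1 oee eqxx.
Qed.

End Fibre.

(** * Smooth orthonormal frames with prescribed value at a point *)

Section Frames.
Variables (R : realType) (n k : nat) (M : smooth_manifold R n).
Variables (E : vector_bundle M k) (g : bundle_metric E).

(** The metric is smooth by definition on the frame of a trivialization only;
    the general case follows by expanding both sections in that frame. *)
Lemma smooth_fun_inner (a : triv E) (x y : forall q : M, E q) :
  smooth_section (triv_dom a) x -> smooth_section (triv_dom a) y ->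
  smooth_fun (triv_dom a) (fun q => g q (x q) (y q)).
Proof.
move=> sx sy; have oU := triv_dom_open a.
pose c (z : forall q : M, E q) i q :=
  coord [tuple triv_frame a l q | l < k] i (z q).
have sc z i : smooth_section (triv_dom a) z -> smooth_fun (triv_dom a) (c z i).
  by move=> sz; have := sz a i; rewrite setIid.
pose G q := \sum_i \sum_j c x i q * (c y j q *
  g q (triv_frame a i q) (triv_frame a j q)).
apply: (@smooth_fun_eq _ _ _ _ G) => // [q Uq|].
  rewrite [in RHS](triv_frame_coord (x q) Uq) inner_suml; apply: eq_bigr => i _.
  rewrite [in RHS](triv_frame_coord (y q) Uq) inner_sumr; apply: eq_bigr => j _.
  by rewrite innerZl innerZr.
apply: smooth_fun_sum => // i; apply: smooth_fun_sum => // j.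
apply: smooth_funM => //; first exact: sc.
by apply: smooth_funM => //; [exact: sc|exact: inner_smooth].
Qed.

(** One step of the Gram-Schmidt process. Replacing only the [i0]-th section
    keeps the whole family independent, which is what makes the vector to be
    normalized nonzero at every point. The last conclusion, that nothing
    changes where [F] is orthonormal, is what prescribes the value of the
    final frame. *)
Lemma gram_schmidt_step (a : triv E) (F : 'I_k -> forall q : M, E q)
    (i0 : 'I_k) :
  (forall i, smooth_section (triv_dom a) (F i)) ->
  (forall q, triv_dom a q -> lin_indep (fun i => F i q)) ->
  (forall q, triv_dom a q -> forall i j : 'I_k, (i < i0)%N -> (j < i0)%N ->
     g q (F i q) (F j q) = (i == j)%:R) ->
  exists F' : 'I_k -> forall q : M, E q,
    [/\ forall i, smooth_section (triv_dom a) (F' i),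
        forall q, triv_dom a q -> lin_indep (fun i => F' i q),
        forall q, triv_dom a q -> forall i j : 'I_k, (i <= i0)%N -> (j <= i0)%N ->
          g q (F' i q) (F' j q) = (i == j)%:R &
        forall q, orthonormal_basis g (fun i => F i q) ->
          forall i, F' i q = F i q].
Proof.
move=> sF iF oF; have oU := triv_dom_open a.
pose w q : E q := F i0 q +
  \sum_(i : 'I_k | (i < i0)%N) (- g q (F i0 q) (F i q)) *: F i q.
pose r q := (Num.sqrt (g q (w q) (w q)))^-1.
pose F' i q := if i == i0 then r q *: w q else F i q.
have w0 q : triv_dom a q -> w q != 0.
  move=> Uq.
  have := @lin_indep_update _ _ _ (fun i => F i q) i0 (fun i => i < i0)%N
    (fun i => - g q (F i0 q) (F i q)) 1 _ (oner_neq0 _) (iF q Uq).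
  rewrite ltnn => /(_ isT)/(lin_indep_neq0 i0).
  by rewrite eqxx scale1r.
have ww0 q : triv_dom a q -> 0 < g q (w q) (w q).
  by move=> Uq; apply: inner_gt0; exact: w0.
have sw : smooth_section (triv_dom a) w.
  apply: smooth_sectionD => //; apply: smooth_section_sum => // i _.
  apply: smooth_sectionZ => //.
  apply: (@smooth_fun_eq _ _ _ _ (fun q => -1 * g q (F i0 q) (F i q))) => //.
    by move=> q _; rewrite mulN1r.
  by apply: smooth_funM; [|exact: smooth_fun_cst|exact: smooth_fun_inner].
have sr : smooth_fun (triv_dom a) r.
  by apply: smooth_fun_invsqrt => //; exact: smooth_fun_inner.
have wF q (j : 'I_k) : triv_dom a q -> (j < i0)%N -> g q (w q) (F j q) = 0.
  move=> Uq ji; rewrite innerDl inner_suml (bigD1 j)//= big1 => [|i /andP[ii ij]].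
    by rewrite innerZl (oF q Uq j j)// eqxx mulr1 addr0 subrr.
  by rewrite innerZl (oF q Uq i j)// (negPf ij) mulr0.
exists F'; split.
- by move=> i; rewrite /F'; case: (i == i0) => //; exact: smooth_sectionZ.
- move=> q Uq; apply: (lin_indep_update (v := fun i => F i q)); last exact: iF.
    by rewrite ltnn.
  by rewrite invr_eq0 gt_eqF// sqrtr_gt0 ww0.
- move=> q Uq i j ii0 ji0; rewrite /F'.
  have lt_i0 (l : 'I_k) : (l <= i0)%N -> l != i0 -> (l < i0)%N.
    by move=> li0 lne; rewrite ltn_neqAle li0 andbT.
  have [->|ii] := eqVneq i i0; have [jE|ji] := eqVneq j i0.
  + rewrite innerZl innerZr /r mulrA -invfM -expr2 sqr_sqrtr ?ltW ?ww0//.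
    by rewrite mulVf// gt_eqF// ww0.
  + by rewrite innerZl wF ?lt_i0// mulr0.
  + by rewrite innerZr inner_sym wF ?lt_i0// mulr0 jE (negPf ii).
  + by rewrite oF ?lt_i0.
- move=> q [_ oq] i; rewrite /F'; case: eqP => // ->.
  have wE : w q = F i0 q.
    rewrite /w big1 ?addr0// => j ji.
    by rewrite oq (_ : (i0 == j) = false) ?oppr0 ?scale0r// -val_eqE gtn_eqF.
  by rewrite /r wE oq eqxx sqrtr1 invr1 scale1r.
Qed.

(** The start of the process combines the frame of the trivialization with the
    constant coefficients of [e]; it is a frame on the whole domain of the
    trivialization, so the domain never has to shrink. *)
Lemma orthonormal_frame_extension (a : triv E) p (e : 'I_k -> E p) :
  triv_dom a p -> orthonormal_basis g e ->
  exists2 F : 'I_k -> forall q : M, E q,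
    orthonormal_frame g (triv_dom a) F & forall i, F i p = e i.
Proof.
move=> ap oe; have oU := triv_dom_open a.
suff gs m : (m <= k)%N -> exists F : 'I_k -> forall q : M, E q,
    [/\ forall i, smooth_section (triv_dom a) (F i),
        forall q, triv_dom a q -> lin_indep (fun i => F i q),
        forall q, triv_dom a q -> forall i j : 'I_k, (i < m)%N -> (j < m)%N ->
          g q (F i q) (F j q) = (i == j)%:R &
        forall i, F i p = e i].
  have [F [sF _ oF Fp]] := gs k (leqnn k).
  exists F => //; split=> // q Uq.
  by apply: orthonormal_basisP => i j; apply: oF.
elim: m => [_|m IH mk].
  pose A i l := coord [tuple triv_frame a l p | l < k] l (e i).
  exists (fun i q => \sum_l A i l *: triv_frame a l q); split=> //.
  - move=> i; apply: smooth_section_sum => // l _; apply: smooth_sectionZ => //.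
      exact: smooth_fun_cst.
    exact: smooth_section_triv.
  - move=> q Uq c sum0; have cA l : \sum_i c i * A i l = 0.
      move: l; apply: (basis_lin_indep (triv_basis Uq)).
      rewrite -[RHS]sum0; under [RHS]eq_bigr do rewrite scaler_sumr.
      rewrite exchange_big /=; apply: eq_bigr => l _.
      by rewrite scaler_suml; apply: eq_bigr => i _; rewrite scalerA.
    have [be _] := oe; apply: (basis_lin_indep be).
    under eq_bigr => i _ do rewrite (triv_frame_coord (e i) ap) scaler_sumr.
    rewrite exchange_big big1 => //= l _.
    under eq_bigr do rewrite scalerA.
    by rewrite -scaler_suml cA scale0r.
  - by move=> i; rewrite -(triv_frame_coord (e i) ap).
have [F [sF iF oF Fp]] := IH (ltnW mk).
have [F' [sF' iF' oF' F'p]] := gram_schmidt_step (i0 := Ordinal mk) sF iF oF.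
exists F'; split=> // i; rewrite F'p// (_ : (fun i => F i p) = e)//.
by apply/funext.
Qed.

Lemma orthonormal_frame_sub (U V : set M) (e : 'I_k -> forall q : M, E q) :
  V `<=` U -> orthonormal_frame g U e -> orthonormal_frame g V e.
Proof.
move=> VU [se oe]; split=> [i|q /VU]; last exact: oe.
exact: smooth_section_sub VU (se i).
Qed.

End Frames.

(** * Totally symmetric arrays *)

Section SymmetricArrays.
Variables (R : realType) (n : nat).
Implicit Types (h : 'I_n -> 'I_n -> 'I_n -> R).

Definition totally_symmetric h :=
  (forall i j k, h i j k = h j i k) /\ (forall i j k, h i j k = h i k j).

Definition array_trace h (k : 'I_n) : R := \sum_j h j j k.

Definition array_ricci h (a : 'I_n) : R :=
  \sum_j \sum_k (h j j k * h a a k - h j a k ^+ 2).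

Definition array_bound h : R :=
  (n%:R - 1) / (4 * n%:R) * \sum_k array_trace h k ^+ 2.

(** The sum of squares whose vanishing describes equality. Writing [x] for
    [h a a a], [t] for the sum of the other [h j j a] and [S = x + t], the terms
    of [k = a] in the inequality contribute
    [(n-1)/(4n) * S^2 - x * t + \sum_(j != a) (h j j a)^2]. The extremal
    configuration has all these [h j j a] equal to [S / (2n)], which is how the
    first two squares arise. For [k != a] the terms
    [(n-1)/(4n) * S_k^2 - h a a k * S_k + 2 * (h a a k)^2] are completed to a
    square, the factor [2] coming from
    [(h k a a)^2 + (h a a k)^2]; what remains is
    [(n-1)/(4n) - 1/8 = (n-2)/(8n)] times [S_k^2]. The last sum consists of the
    off-diagonal terms that are dropped in the inequality. *)
Definition array_deficit h (a : 'I_n) : R :=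
  (\sum_(j | j != a) h j j a - (n%:R - 1) / (2 * n%:R) * array_trace h a) ^+ 2
  + \sum_(j | j != a) (h j j a - array_trace h a / (2 * n%:R)) ^+ 2
  + \sum_(k | k != a) (2 * (h a a k - array_trace h k / 4) ^+ 2
       + (n%:R - 2) / (8 * n%:R) * array_trace h k ^+ 2)
  + \sum_(k | k != a) \sum_(j | (j != a) && (j != k)) h j a k ^+ 2.

Lemma array_deficitE h a : (2 <= n)%N -> totally_symmetric h ->
  array_bound h - array_ricci h a = array_deficit h a.
Proof.
move=> n2 [s1 s2].
have n0 : n%:R != 0 :> R by rewrite pnatr_eq0; case: (n) n2.
pose S := array_trace h.
have Ric : array_ricci h a =
    \sum_k (S k * h a a k) - \sum_k \sum_j h j a k ^+ 2.
  rewrite /array_ricci exchange_big /= -sumrB; apply: eq_bigr => k _.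
  by rewrite sumrB -mulr_suml.
(* By symmetry [h a a k ^+ 2] occurs as [(j, k) = (a, k)] and as [(k, a)], and
   the square of the diagonal entry [h k a k] is that of [h k k a]. *)
have Sq : \sum_k \sum_j h j a k ^+ 2 = h a a a ^+ 2
    + \sum_(k | k != a) (2 * h a a k ^+ 2) + \sum_(k | k != a) h k k a ^+ 2
    + \sum_(k | k != a) \sum_(j | (j != a) && (j != k)) h j a k ^+ 2.
  rewrite (bigD1 a)//= (bigD1 a)//=.
  have -> : \sum_(i | i != a) h i a a ^+ 2 = \sum_(k | k != a) h a a k ^+ 2.
    by apply: eq_bigr => i _; rewrite s1 s2.
  rewrite -!addrA; congr (_ + _).
  rewrite [in RHS]addrA -!big_split /=; apply: eq_bigr => k ka.
  rewrite (bigD1 a)//= (bigD1 k)//= [h k a k]s2; ring.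
have cardE : \sum_(j < n | j != a) (1 : R) = n%:R - 1.
  have := sumr_const (mem 'I_n) (1 : R).
  rewrite card_ord (bigD1 a)//= => <-; ring.
have Sa : \sum_(j | j != a) h j j a = S a - h a a a.
  by rewrite /S /array_trace [in RHS](bigD1 a)//=; ring.
have E1 : \sum_(j | j != a) (h j j a - S a / (2 * n%:R)) ^+ 2 =
    \sum_(j | j != a) h j j a ^+ 2 - (S a - h a a a) * S a / n%:R
    + (n%:R - 1) * S a ^+ 2 / (4 * n%:R ^+ 2).
  transitivity (\sum_(j | j != a) (h j j a ^+ 2 - h j j a * (S a / n%:R)
      + 1 * ((S a) ^+ 2 / (4 * n%:R ^+ 2)))).
    by apply: eq_bigr => j _; field.
  by rewrite big_split sumrB -!mulr_suml /= Sa cardE !mulrA.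
rewrite /array_deficit /array_bound Ric Sq -/S E1 Sa.
rewrite (bigD1 a)//= [\sum_k (S k * _)](bigD1 a)//=.
have -> : \sum_(k | k != a) (2 * (h a a k - S k / 4) ^+ 2
       + (n%:R - 2) / (8 * n%:R) * S k ^+ 2) =
   (n%:R - 1) / (4 * n%:R) * \sum_(k | k != a) S k ^+ 2
   - \sum_(k | k != a) S k * h a a k + \sum_(k | k != a) 2 * h a a k ^+ 2.
  by rewrite mulr_sumr -sumrB -big_split /=; apply: eq_bigr => k _; field.
by field.
Qed.

Lemma psumr_le0 (I : finType) (P : pred I) (F : I -> R) :
  (forall i, P i -> 0 <= F i) -> \sum_(i | P i) F i <= 0 ->
  forall i, P i -> F i = 0.
Proof.
move=> F0 s0; apply/psumr_eq0P => //.
by apply/eqP; rewrite eq_le s0 sumr_ge0.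
Qed.

Lemma array_deficit_ge0 h a : (2 <= n)%N -> 0 <= array_deficit h a.
Proof.
move=> n2; have n2R : 0 <= n%:R - 2 :> R by rewrite subr_ge0 ler_nat.
rewrite /array_deficit !addr_ge0 ?sqr_ge0//; apply: sumr_ge0 => k _.
- exact: sqr_ge0.
- by rewrite addr_ge0// mulr_ge0 ?sqr_ge0// divr_ge0// mulr_ge0.
- by apply: sumr_ge0 => j _; exact: sqr_ge0.
Qed.

Lemma array_deficit_eq0 h a : (2 <= n)%N -> array_deficit h a = 0 ->
  [/\ forall j, j != a -> h j j a = array_trace h a / (2 * n%:R),
      forall k, k != a -> h a a k = array_trace h k / 4,
      forall k, k != a -> (2 < n)%N -> array_trace h k = 0 &
      forall j k, k != a -> j != a -> j != k -> h j a k = 0].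
Proof.
move=> n2; have n2R : 0 <= n%:R - 2 :> R by rewrite subr_ge0 ler_nat.
have n0R : 0 <= (n%:R - 2) / (8 * n%:R) :> R by rewrite divr_ge0// mulr_ge0.
rewrite /array_deficit.
set A := _ ^+ 2; set B := \sum_(j | j != a) (_ ^+ 2).
set C := \sum_(k | k != a) (_ + _).
set D := \sum_(k | k != a) _ => ABCD.
have pC k : k != a -> 0 <= 2 * (h a a k - array_trace h k / 4) ^+ 2
       + (n%:R - 2) / (8 * n%:R) * array_trace h k ^+ 2.
  by rewrite addr_ge0// mulr_ge0 ?sqr_ge0.
have pD k : k != a -> 0 <= \sum_(j | (j != a) && (j != k)) h j a k ^+ 2.
  by move=> _; apply: sumr_ge0 => j _; exact: sqr_ge0.
have pB j : j != a -> 0 <= (h j j a - array_trace h a / (2 * n%:R)) ^+ 2.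
  by move=> _; exact: sqr_ge0.
have A0 : 0 <= A by exact: sqr_ge0.
have B0 : 0 <= B by apply: sumr_ge0.
have C0 : 0 <= C by exact: sumr_ge0.
have D0 : 0 <= D by exact: sumr_ge0.
have B0' : B <= 0 by lra.
have C0' : C <= 0 by lra.
have D0' : D <= 0 by lra.
have zB := psumr_le0 pB B0'.
have zC := psumr_le0 pC C0'.
have zD := psumr_le0 pD D0'.
split=> [j ja|k ka|k ka n3|j k ka ja jk].
- by apply/eqP; rewrite -subr_eq0 -sqrf_eq0 (zB j ja).
- have := zC k ka; set u := (_ - _) ^+ 2; set w := _ / _ * _ => uw.
  have u0 : 0 <= u by exact: sqr_ge0.
  have w0 : 0 <= w by rewrite mulr_ge0 ?sqr_ge0.
  by apply/eqP; rewrite -subr_eq0 -sqrf_eq0; apply/eqP; rewrite -/u; lra.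
- have := zC k ka; set u := (_ - _) ^+ 2; set w := _ / _ * _ => uw.
  have u0 : 0 <= u by exact: sqr_ge0.
  have w0 : 0 <= w by rewrite mulr_ge0 ?sqr_ge0.
  have /eqP : w = 0 by lra.
  rewrite mulf_eq0 sqrf_eq0 => /orP[|/eqP//].
  rewrite mulf_eq0 invr_eq0 mulf_eq0 subr_eq0 eqr_nat !pnatr_eq0/=.
  by case: (n) n3 => [|[|[|]]].
- apply/eqP; rewrite -sqrf_eq0.
  have jakE : (j != a) && (j != k) by rewrite ja.
  have pj i : (i != a) && (i != k) -> 0 <= h i a k ^+ 2.
    by move=> _; exact: sqr_ge0.
  by rewrite (psumr_le0 pj _ jakE)// zD.
Qed.

(** Equality at [a] gives [S_k = 0] for all [k != a]; two different choices of
    [a] cover every [k]. Once all traces vanish, the entries with two equal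
    indices vanish one by one, the diagonal ones last because they are
    determined by the traces. *)
Lemma array_deficit_eq0_gt2 h : (2 < n)%N -> totally_symmetric h ->
  (forall a, array_deficit h a = 0) -> forall i j k, h i j k = 0.
Proof.
move=> n3 [s1 s2] d0; have n2 := ltnW n3.
have ex_ne (k : 'I_n) : exists a : 'I_n, k != a.
  have [a|/(_ (Ordinal n2))/negP/negP/eqP k1] := pickP (fun a => k != a).
    by exists a.
  by exists (Ordinal (ltnW n2)); rewrite k1.
have S0 k : array_trace h k = 0.
  by have [a ka] := ex_ne k; have [_ _ -> ] := array_deficit_eq0 n2 (d0 a).
have off j k : j != k -> h j j k = 0.
  have [offE _ _ _] := array_deficit_eq0 n2 (d0 k).
  by move=> jk; rewrite offE// S0 mul0r.
have diag k : h k k k = 0.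
  have := S0 k; rewrite /array_trace (bigD1 k)//= big1 ?addr0// => j.
  exact: off.
move=> i j k; have [<-|ij] := eqVneq i j.
  by have [<-|/off] := eqVneq i k.
have [<-|ik] := eqVneq i k; first by rewrite s2 off// eq_sym.
have [<-|jk] := eqVneq j k; first by rewrite s1 s2 off// eq_sym.
have [_ _ _ distinct0] := array_deficit_eq0 n2 (d0 j).
by apply: distinct0; rewrite // eq_sym.
Qed.

End SymmetricArrays.

(** * The tensors at a point *)

Lemma sum_dim2 (V : nmodType) n (F : 'I_n -> V) (i1 i2 : 'I_n) : n = 2%N ->
  i1 != i2 -> \sum_i F i = F i1 + F i2.
Proof.
move=> n2 i12; rewrite (bigD1 i1)//= (bigD1 i2) 1?eq_sym//= big1 ?addr0// => i.
case/andP => ii1 ii2; exfalso; move: i12 ii1 ii2; rewrite -!val_eqE /=.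
by have := ltn_ord i1; have := ltn_ord i2; have := ltn_ord i; lia.
Qed.

Lemma ord_dim2 n (i1 i2 l : 'I_n) : n = 2%N -> i1 != i2 -> l = i1 \/ l = i2.
Proof.
move=> n2; rewrite -val_eqE /= => i12.
have [/val_inj|li1] := eqVneq (val l) (val i1); [by left|right; apply/val_inj].
by have := (ltn_ord i1, ltn_ord i2, ltn_ord l); case=> -[]; move: li1 => /=; lia.
Qed.

Section AtAPoint.
Variables (R : realType) (n s : nat) (M : smooth_manifold R n).
Variables (g : bundle_metric (tangent_bundle M)).
Variables (B : vector_bundle M (n + s)) (gB : bundle_metric B).
Variables (zeta : forall p : M, tangent_bundle M p -> tangent_bundle M p -> B p).
Variables (T : forall p : M, tangent_bundle M p -> tangent_bundle M p ->
           tangent_bundle M p -> tangent_bundle M p -> R).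
Hypothesis n_ge2 : (2 <= n)%N.
Hypothesis zeta_tensor : symmetric_tensor_field12 zeta.
Hypothesis T_tensor : tensor_field04 T.
Hypothesis T_Gauss : algebraic_Gauss gB zeta T.
Variable p : M.
Local Notation TpM := (tangent_bundle M p).
Implicit Types (e : 'I_n -> TpM) (f : 'I_(n + s) -> B p) (X Y : TpM).

Definition adapted_basis e f : Prop :=
  [/\ orthonormal_basis gB f,
      forall i j k : 'I_n,
        component12 gB zeta e f j k (lshift s i) =
          component12 gB zeta e f k i (lshift s j) /\
        component12 gB zeta e f k i (lshift s j) =
          component12 gB zeta e f i j (lshift s k) &
      forall (i j : 'I_n) (r : 'I_s),
        component12 gB zeta e f i j (rshift n r) = 0].

Definition components e f (i j k : 'I_n) : R :=
  component12 gB zeta e f i j (lshift s k).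

Definition ricci_bound e : R :=
  (n%:R - 1) / (4 * n%:R) * gB p (trace12 zeta e) (trace12 zeta e).

Lemma zetaC X Y : zeta X Y = zeta Y X.
Proof. by have [zC _ _ _] := zeta_tensor. Qed.

Lemma zeta_linearr X : linear (zeta (p := p) X).
Proof. by have [_ _ zr _] := zeta_tensor. Qed.

Lemma zeta_linearl Y : linear (fun X => zeta (p := p) X Y).
Proof. by have [_ zl _ _] := zeta_tensor. Qed.

Lemma zetaD X Y Z : zeta X (Y + Z) = zeta X Y + zeta X Z.
Proof. by have := zeta_linearr X 1 Y Z; rewrite !scale1r. Qed.

Lemma zeta0 X : zeta X 0 = 0.
Proof. by apply: (addrI (zeta X 0)); rewrite -zetaD !addr0. Qed.

Lemma zetaZ X a Y : zeta X (a *: Y) = a *: zeta X Y.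
Proof. by have := zeta_linearr X a Y 0; rewrite zeta0 !addr0. Qed.

Lemma zeta_basis_eq0 e : orthonormal_basis g e ->
  (forall i j, zeta (e i) (e j) = 0) -> forall X Y, zeta X Y = 0.
Proof.
move=> oe z0.
have z1 i Y : zeta (e i) Y = 0.
  rewrite (orthonormal_expansion Y oe).
  elim/big_rec: _ => [|j Z _ zZ]; first exact: zeta0.
  by rewrite zetaD zetaZ z0 scaler0 zZ addr0.
move=> X Y; rewrite zetaC (orthonormal_expansion X oe).
elim/big_rec: _ => [|j Z _ zZ]; first exact: zeta0.
by rewrite zetaD zetaZ zZ zetaC z1 scaler0 addr0.
Qed.

Lemma trace12_orthonormal e e' : orthonormal_basis g e ->
  orthonormal_basis g e' -> trace12 zeta e = trace12 zeta e'.
Proof.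
by apply: trace_orthonormal; [exact: zeta_linearl|exact: zeta_linearr].
Qed.

Lemma ricci_orthonormal e e' X : orthonormal_basis g e ->
  orthonormal_basis g e' -> ricci T e X = ricci T e' X.
Proof.
have [T1 _ _ T4 _] := T_tensor.
apply: (@trace_orthonormal _ _ _ _ _ _ _ R^o (fun u v => T u X X v)).
- by move=> v; exact: T1.
- by move=> u; exact: T4.
Qed.

Lemma components_symmetric e f :
  adapted_basis e f -> totally_symmetric (components e f).
Proof.
move=> [_ ad _].
have sC i j k : components e f i j k = components e f j i k.
  by rewrite /components /component12 zetaC.
split=> // i j k; rewrite [RHS]sC.
by have [E1 E2] := ad i j k; rewrite /components E2.
Qed.

Lemma zeta_components e f i j : adapted_basis e f ->
  zeta (e i) (e j) = \sum_k components e f i j k *: f (lshift s k).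
Proof.
move=> [of_ _ ad0]; rewrite {1}(orthonormal_expansion (zeta (e i) (e j)) of_).
rewrite big_split_ord /= [X in _ + X]big1 ?addr0// => r _.
by have := ad0 i j r; rewrite /component12 => ->; rewrite scale0r.
Qed.

Lemma inner_components e f i j k l : adapted_basis e f ->
  gB p (zeta (e i) (e j)) (zeta (e k) (e l)) =
  \sum_m components e f i j m * components e f k l m.
Proof.
move=> ad; rewrite (zeta_components i j ad) inner_suml.
by apply: eq_bigr => m _; rewrite innerZl (inner_sym gB).
Qed.

(** The Gauss equation makes the Ricci curvature and the squared trace
    quadratic expressions in the components of [zeta] along an adapted pair of
    bases, so that the inequality becomes one about symmetric arrays. *)
Lemma ricci_bound_sub e f a : adapted_basis e f ->
  ricci_bound e - ricci T e (e a) = array_deficit (components e f) a.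
Proof.
move=> ad; rewrite -array_deficitE//; last exact: components_symmetric.
congr (_ * _ - _).
  rewrite /trace12 inner_suml.
  under eq_bigr => i _ do rewrite inner_sumr.
  under eq_bigr => i _ do under eq_bigr => j _ do
    rewrite (inner_components _ _ _ _ ad).
  under [RHS]eq_bigr do rewrite expr2 /array_trace big_distrlr /=.
  rewrite [RHS]exchange_big /=; apply: eq_bigr => i _.
  by rewrite [RHS]exchange_big.
apply: eq_bigr => j _; rewrite T_Gauss zetaC (zetaC (e a) (e j)).
rewrite !(inner_components _ _ _ _ ad) -sumrB.
by apply: eq_bigr => m _; rewrite expr2.
Qed.

Lemma ricci_le_bound e f a : adapted_basis e f ->
  ricci T e (e a) <= ricci_bound e.
Proof.
by move=> ad; rewrite -subr_ge0 (ricci_bound_sub _ ad); exact: array_deficit_ge0.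
Qed.

Lemma ricci_eq_bound e f a : adapted_basis e f ->
  ricci T e (e a) = ricci_bound e -> array_deficit (components e f) a = 0.
Proof. by move=> ad E; rewrite -(ricci_bound_sub a ad) E subrr. Qed.

Lemma ricci_eq_gt2 e f : (2 < n)%N -> orthonormal_basis g e ->
  adapted_basis e f -> (forall a, ricci T e (e a) = ricci_bound e) ->
  forall X Y, zeta X Y = 0.
Proof.
move=> n3 oe ad E; apply: (zeta_basis_eq0 oe) => i j.
rewrite (zeta_components i j ad) big1// => k _.
rewrite array_deficit_eq0_gt2 ?scale0r//; first exact: components_symmetric.
by move=> a; exact: ricci_eq_bound.
Qed.

Section Dimension2.
Hypothesis n2 : n = 2%N.
Variables (i1 i2 : 'I_n).
Hypothesis i12 : i1 != i2.

Let i21 : i2 != i1. Proof. by rewrite eq_sym. Qed.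

Let nR : n%:R = 2 :> R. Proof. by rewrite n2. Qed.

(** Named so that vector identities in the plane of these two vectors reduce to
    ring identities between coefficients. *)
Definition comb f (x y : R) : B p :=
  x *: f (lshift s i1) + y *: f (lshift s i2).

Lemma combD f x y x' y' : comb f x y + comb f x' y' = comb f (x + x') (y + y').
Proof. by rewrite /comb !scalerDl addrACA. Qed.

Lemma combZ f a x y : a *: comb f x y = comb f (a * x) (a * y).
Proof. by rewrite /comb scalerDr !scalerA. Qed.

Lemma inner_comb f x y x' y' : orthonormal_basis gB f ->
  gB p (comb f x y) (comb f x' y') = x * x' + y * y'.
Proof.
move=> [_ of_]; rewrite !(innerDl, innerDr, innerZl, innerZr) !of_.
rewrite !(inj_eq (@lshift_inj _ _)) !eqxx (negPf i12) (negPf i21) /=.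
ring.
Qed.

Lemma zeta_plane (u v : TpM) x y : zeta (x *: u + y *: v) (x *: u + y *: v) =
  x ^+ 2 *: zeta u u + (2 * x * y) *: zeta u v + y ^+ 2 *: zeta v v.
Proof.
rewrite zetaD !zetaZ ![zeta (_ + _) _]zetaC !zetaD !zetaZ (zetaC v u).
rewrite !scalerDr !scalerA -!expr2 -!addrA; congr (_ + _).
by rewrite addrA -scalerDl; congr (_ *: _ + _); ring.
Qed.

Lemma ricci_eq_dim2 e f : adapted_basis e f ->
  ricci T e (e i1) = ricci_bound e -> exists a b,
  [/\ zeta (e i1) (e i1) = comb f (3 * a) b,
      zeta (e i1) (e i2) = comb f b a &
      zeta (e i2) (e i2) = comb f a (3 * b)].
Proof.
move=> ad /(ricci_eq_bound ad) d0.
have [s1 s2] := components_symmetric ad.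
have [/(_ i2 i21) h221 /(_ i2 i21) h112 _ _] := array_deficit_eq0 n_ge2 d0.
rewrite nR /array_trace !(sum_dim2 _ n2 i12) in h221 h112.
set h := components e f in h221 h112 s1 s2.
have h111 : h i1 i1 i1 = 3 * h i2 i2 i1 by lra.
have h222 : h i2 i2 i2 = 3 * h i1 i1 i2 by lra.
exists (h i2 i2 i1), (h i1 i1 i2).
split; rewrite (zeta_components _ _ ad) (sum_dim2 _ n2 i12) -/h ?h111 ?h222//.
by rewrite s2 (s1 i1 i2 i2) (s2 i2 i1 i2).
Qed.

(** In dimension two equality at [e i1] says that the cubic form of [zeta] is
    [3 * l(X) * |X|^2] for a linear form [l] with coefficients [a] and [b]. It
    takes the normal form once [e i1] points in the direction dual to [l]. *)
Lemma ricci_eq_dim2_normal_form e : orthonormal_basis g e ->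
  (forall e, orthonormal_basis g e -> exists f, adapted_basis e f) ->
  (forall X, g p X X = 1 -> ricci T e X = ricci_bound e) ->
  (forall X Y, zeta X Y = 0) \/
  exists e' f mu, [/\ orthonormal_basis g e', orthonormal_basis gB f,
    zeta (e' i1) (e' i1) = (3 * mu) *: f (lshift s i1),
    zeta (e' i2) (e' i2) = mu *: f (lshift s i1) &
    zeta (e' i1) (e' i2) = mu *: f (lshift s i2)].
Proof.
move=> oe ex_ad ricE; have [f ad] := ex_ad e oe.
have [_ oee] := oe; have [of_ _ _] := ad.
have [|a [b [z11 z12 z22]]] := ricci_eq_dim2 ad.
  by apply: ricE; rewrite oee eqxx.
pose m2 := a ^+ 2 + b ^+ 2.
have [m0|m0] := eqVneq m2 0.
  left; have a0 : a = 0 by rewrite /m2 in m0; nra.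
  have b0 : b = 0 by rewrite /m2 in m0; nra.
  apply: (zeta_basis_eq0 oe) => i j.
  have comb0 : comb f 0 0 = 0 by rewrite /comb !scale0r addr0.
  rewrite a0 b0 !mulr0 comb0 in z11 z12 z22.
  have dim2 (l : 'I_n) : l = i1 \/ l = i2 by exact: ord_dim2.
  by case: (dim2 i) => ->; case: (dim2 j) => -> //; rewrite zetaC.
right.
have m2_gt0 : 0 < m2 by rewrite lt_neqAle eq_sym m0 addr_ge0 ?sqr_ge0.
pose m := Num.sqrt m2.
have mm : m ^+ 2 = a ^+ 2 + b ^+ 2 by rewrite sqr_sqrtr ?ltW.
have m_gt0 : 0 < m by rewrite sqrtr_gt0.
have m_neq0 : m != 0 by rewrite gt_eqF.
pose X := (a / m) *: e i1 + (b / m) *: e i2.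
have X1 : g p X X = 1.
  rewrite /X !(innerDl, innerDr, innerZl, innerZr) !oee !eqxx.
  rewrite (negPf i12) eq_sym (negPf i12) /=.
  transitivity ((a ^+ 2 + b ^+ 2) / m ^+ 2); first by field.
  by rewrite -mm divff ?expf_neq0.
have [e' oe' e'X] := orthonormal_basis_through i1 oe X1.
have [f' ad'] := ex_ad e' oe'; have [of' _ _] := ad'.
have bound_e' : ricci_bound e' = ricci_bound e.
  by rewrite /ricci_bound (trace12_orthonormal oe' oe).
have [|a' [b' [z11' z12' z22']]] := ricci_eq_dim2 ad'.
  by rewrite bound_e' -(ricci_orthonormal _ oe oe') ricE// e'X.
(* The bases [f] and [f'] are unrelated, so [a'] and [b'] are compared with [a]
   and [b] through two invariants: the lengths of [trace zeta] and of
   [zeta X X]. Together they force [b' = 0]. *)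
have traceE : 16 * (a ^+ 2 + b ^+ 2) = 16 * (a' ^+ 2 + b' ^+ 2).
  have := trace12_orthonormal oe oe'.
  rewrite /trace12 !(sum_dim2 _ n2 i12) z11 z22 z11' z22' !combD => trE.
  have : gB p (comb f (3 * a + a) (b + 3 * b))
           (comb f (3 * a + a) (b + 3 * b)) =
      gB p (comb f' (3 * a' + a') (b' + 3 * b'))
           (comb f' (3 * a' + a') (b' + 3 * b')) by rewrite trE.
  by rewrite !inner_comb// => E; lra.
have normE : 9 * (a ^+ 2 + b ^+ 2) = 9 * a' ^+ 2 + b' ^+ 2.
  have zXX : zeta X X = comb f (3 * a) (3 * b).
    have mdiv : (a ^+ 2 + b ^+ 2) / m ^+ 2 = 1 by rewrite -mm divff ?expf_neq0.
    rewrite zeta_plane z11 z12 z22 !combZ !combD; congr (comb f _ _).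
      transitivity (3 * a * ((a ^+ 2 + b ^+ 2) / m ^+ 2)); first by field.
      by rewrite mdiv mulr1.
    transitivity (3 * b * ((a ^+ 2 + b ^+ 2) / m ^+ 2)); first by field.
    by rewrite mdiv mulr1.
  have : gB p (comb f (3 * a) (3 * b)) (comb f (3 * a) (3 * b)) =
      gB p (comb f' (3 * a') b') (comb f' (3 * a') b').
    by rewrite -zXX -z11' e'X.
  by rewrite !inner_comb// => E; lra.
have b'0 : b' = 0 by nra.
exists e', f', a'.
rewrite b'0 /comb !(mulr0, scale0r, addr0, add0r) in z11' z12' z22'.
by split.
Qed.

(** The converse in dimension two: both sides equal [2 * mu^2]. *)
Lemma normal_form_ricci_eq e e' f mu X : orthonormal_basis g e ->
  orthonormal_basis g e' -> orthonormal_basis gB f ->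
  zeta (e' i1) (e' i1) = (3 * mu) *: f (lshift s i1) ->
  zeta (e' i2) (e' i2) = mu *: f (lshift s i1) ->
  zeta (e' i1) (e' i2) = mu *: f (lshift s i2) ->
  g p X X = 1 -> ricci T e X = ricci_bound e.
Proof.
have comb1 x : x *: f (lshift s i1) = comb f x 0 by rewrite /comb scale0r addr0.
have comb2 x : x *: f (lshift s i2) = comb f 0 x by rewrite /comb scale0r add0r.
rewrite !comb1 comb2 => oe oe' of_ z11 z22 z12 X1.
pose x := g p X (e' i1); pose y := g p X (e' i2).
have XE : X = x *: e' i1 + y *: e' i2.
  by rewrite {1}(orthonormal_expansion X oe') (sum_dim2 _ n2 i12).
have xy1 : x ^+ 2 + y ^+ 2 = 1.
  by rewrite -X1 (inner_parseval X X oe') (sum_dim2 _ n2 i12) !expr2.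
rewrite (ricci_orthonormal X oe oe') /ricci_bound (trace12_orthonormal oe oe').
have z1X : zeta (e' i1) X = comb f (3 * mu * x) (mu * y).
  by rewrite XE zetaD !zetaZ z11 z12 !combZ combD; congr (comb f _ _); ring.
have z2X : zeta (e' i2) X = comb f (mu * y) (mu * x).
  rewrite XE zetaD !zetaZ (zetaC (e' i2) (e' i1)) z12 z22 !combZ combD.
  by congr (comb f _ _); ring.
have zXX : zeta X X =
    comb f (mu * (3 * x ^+ 2 + y ^+ 2)) (2 * x * y * mu).
  rewrite {1 2}XE zeta_plane z11 z12 z22 !combZ !combD.
  by congr (comb f _ _); ring.
rewrite /ricci /ricci_tensor /trace12 !(sum_dim2 _ n2 i12) !T_Gauss.
rewrite !(zetaC X) z11 z22 z1X z2X zXX combD !inner_comb// nR.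
apply/eqP; rewrite -subr_eq0; apply/eqP.
transitivity (2 * mu ^+ 2 * (x ^+ 2 + y ^+ 2 - 1)); first by field.
by rewrite xy1 subrr mulr0.
Qed.

End Dimension2.

End AtAPoint.

(** * The inequality and its equality case *)

Theorem theorem3p3 (R : realType) (n s : nat) (n_ge2 : (2 <= n)%N)
    (M : smooth_manifold R n) (g : bundle_metric (tangent_bundle M))
    (B : vector_bundle M (n + s)) (gB : bundle_metric B)
    (zeta : forall p : M, tangent_bundle M p -> tangent_bundle M p -> B p)
    (zeta_tensor : symmetric_tensor_field12 zeta)
    (zeta_sym : forall (p : M) (e : 'I_n -> tangent_bundle M p),
       orthonormal_basis g e ->
       exists f : 'I_(n + s) -> B p,
         [/\ orthonormal_basis gB f,
             forall i j k : 'I_n,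
               component12 gB zeta e f j k (lshift s i) =
                 component12 gB zeta e f k i (lshift s j) /\
               component12 gB zeta e f k i (lshift s j) =
                 component12 gB zeta e f i j (lshift s k) &
             forall (i j : 'I_n) (r : 'I_s),
               component12 gB zeta e f i j (rshift n r) = 0])
    (T : forall p : M, tangent_bundle M p -> tangent_bundle M p ->
           tangent_bundle M p -> tangent_bundle M p -> R)
    (T_tensor : tensor_field04 T)
    (T_curvature : curvature_like T)
    (T_Gauss : algebraic_Gauss gB zeta T)
    (p : M) (e : 'I_n -> tangent_bundle M p)
    (e_orthonormal : orthonormal_basis g e) :
  let bound := (n%:R - 1) / (4 * n%:R) *
                 gB p (trace12 zeta e) (trace12 zeta e) in
  (forall X : tangent_bundle M p, g p X X = 1 -> ricci T e X <= bound) /\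
  ((forall X : tangent_bundle M p, g p X X = 1 -> ricci T e X = bound) <->
   (forall X Y : tangent_bundle M p, zeta p X Y = 0) \/
   (n = 2%N /\
    exists (U : set M) (E : 'I_n -> forall q : M, tangent_bundle M q)
           (F : 'I_(n + s) -> forall q : M, B q) (mu : M -> R),
      let i1 : 'I_n := Ordinal (ltnW n_ge2) in
      let i2 : 'I_n := Ordinal n_ge2 in
      [/\ open U /\ U p,
          orthonormal_frame g U E,
          orthonormal_frame gB U F,
          smooth_fun U mu &
          [/\ zeta p (E i1 p) (E i1 p) = (3 * mu p) *: F (lshift s i1) p,
              zeta p (E i2 p) (E i2 p) = mu p *: F (lshift s i1) p &
              zeta p (E i1 p) (E i2 p) = mu p *: F (lshift s i2) p]])).
Proof.
move=> bound; pose i1 : 'I_n := Ordinal (ltnW n_ge2).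
pose i2 : 'I_n := Ordinal n_ge2.
have i12 : i1 != i2 by [].
have zsym (e' : 'I_n -> tangent_bundle M p) : orthonormal_basis g e' ->
    exists f, adapted_basis gB zeta e' f.
  exact: zeta_sym.
split=> [X X1|].
  have [e' oe' e'X] := orthonormal_basis_through i1 e_orthonormal X1.
  have [f' ad'] := zsym e' oe'.
  rewrite (ricci_orthonormal T_tensor X e_orthonormal oe') -e'X.
  apply: le_trans (ricci_le_bound n_ge2 zeta_tensor T_Gauss i1 ad') _.
  by rewrite /ricci_bound (trace12_orthonormal zeta_tensor oe' e_orthonormal).
split=> [ricE|[z0 X X1|[n2 [U [E [F [mu]]]]]]].
- have [n3|] := ltnP 2 n.
    left; have [f ad] := zsym e e_orthonormal; have [_ oe] := e_orthonormal.
    apply: (ricci_eq_gt2 n_ge2 zeta_tensor T_Gauss n3 e_orthonormal ad) => a.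
    by apply: ricE; rewrite oe eqxx.
  rewrite leq_eqVlt ltnNge n_ge2 orbF => /eqP n2.
  have [|z0|[e' [f' [m [oe' of' z11 z22 z12]]]]] := ricci_eq_dim2_normal_form
    n_ge2 zeta_tensor T_tensor T_Gauss n2 i12 e_orthonormal zsym.
  + exact: ricE.
  + by left.
  right; split=> //.
  have [a ap] := triv_cover (tangent_bundle M) p; have [b bp] := triv_cover B p.
  have [E oE Ep] := orthonormal_frame_extension ap oe'.
  have [F oF Fp] := orthonormal_frame_extension bp of'.
  exists (triv_dom a `&` triv_dom b), E, F, (fun=> m); split.
  + by split; [apply: openI; exact: triv_dom_open|].
  + exact: orthonormal_frame_sub oE.
  + exact: orthonormal_frame_sub oF.
  + exact: smooth_fun_cst.
  + by rewrite !Ep !Fp.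
- rewrite /bound /trace12 big1 => [|i _]; last exact: z0.
  rewrite inner0l mulr0 /ricci /ricci_tensor big1// => j _.
  by rewrite T_Gauss !z0 !inner0l subrr.
- move=> /= [[_ Up] [_ oE] [_ oF] _ [z11 z22 z12]] X X1.
  exact: (normal_form_ricci_eq zeta_tensor T_tensor T_Gauss n2 i12
    e_orthonormal (oE p Up) (oF p Up) z11 z22 z12 X1).
Qed.
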